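(* Let $N\ge 2$, let $\Omega\subset\mathbb{R}^N$ be a bounded domain with $C^{1,1}$ boundary, let $s\in(0,1)$, $p\ge 2$ with $ps<N$, and $p^*_s=Np/(N-ps)$. Let $f:\Omega\times\mathbb{R}\to\mathbb{R}$ be a Carathéodory function such that there exist $c_0>0$, $r\in(p,p^*_s)$ with $|f(x,t)|\le c_0(1+|t|^{r-1})$ for a.e. $x\in\Omega$ and all $t\in\mathbb{R}$. Assume that for a.e. $x\in\Omega$ the mapping $t\mapsto\frac{f(x,t)}{t^{p-1}}$ is strictly decreasing in $(0,\infty)$. Let $u,v\in\mathrm{int}(C^0_s(\overline\Omega)_+)$ be a (weak) subsolution and a (weak) supersolution, respectively, of $$(-\Delta)_p^s u=f(x,u)\ \text{in }\Omega,\qquad u=0\ \text{in }\Omega^c.$$ Then $u\le v$ in $\Omega$.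
   Context: Notation: $\Omega^c=\mathbb{R}^N\setminus\Omega$; functions on $\Omega$ are extended by $0$ to $\mathbb{R}^N$; inequalities between functions hold a.e. For measurable $u:\mathbb{R}^N\to\mathbb{R}$, $[u]_{s,p}=\big[\iint_{\mathbb{R}^N\times\mathbb{R}^N}\frac{|u(x)-u(y)|^p}{|x-y|^{N+ps}}\,dx\,dy\big]^{1/p}$. $W^{s,p}_0(\Omega)=\{u\in L^p(\mathbb{R}^N):[u]_{s,p}<\infty,\ u=0\text{ in }\Omega^c\}$ with norm $\|u\|=[u]_{s,p}$; $W^{s,p}_0(\Omega)_+$ is the set of its nonnegative elements. The fractional $p$-Laplacian $(-\Delta)_p^s:W^{s,p}_0(\Omega)\to W^{-s,p'}(\Omega)$ (the dual space) is defined by $$\langle(-\Delta)_p^su,v\rangle=\iint_{\mathbb{R}^N\times\mathbb{R}^N}\frac{|u(x)-u(y)|^{p-2}(u(x)-u(y))(v(x)-v(y))}{|x-y|^{N+ps}}\,dx\,dy.$$ A (weak) supersolution (resp. subsolution) is $u\in W^{s,p}_0(\Omega)$ such that $\langle(-\Delta)_p^su,\varphi\rangle\ge$ (resp. $\le$) $\int_\Omega f(x,u)\varphi\,dx$ for all $\varphi\in W^{s,p}_0(\Omega)_+$. With ${\rm d}_\Omega^s(x)=\mathrm{dist}(x,\Omega^c)^s$, $C^0_s(\overline\Omega)=\{u\in C^0(\overline\Omega):u/{\rm d}_\Omega^s\text{ has a continuous extension to }\overline\Omega\}$ with norm $\|u\|_{0,s}=\|u/{\rm d}_\Omega^s\|_\infty$;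 $C^0_s(\overline\Omega)_+$ is its cone of nonnegative functions, with interior $\mathrm{int}(C^0_s(\overline\Omega)_+)=\{u\in C^0_s(\overline\Omega):\inf_{\Omega}u/{\rm d}_\Omega^s>0\}$. *)

(* Defs.v *)
From HB Require Import structures.
From mathcomp Require Import all_boot all_order all_algebra.
From mathcomp Require Import all_classical all_reals all_analysis.

Set Implicit Arguments.
Unset Strict Implicit.
Unset Printing Implicit Defensive.

Import Order.TTheory GRing.Theory Num.Theory.
Import numFieldNormedType.Exports.

Local Open Scope classical_set_scope.
Local Open Scope ring_scope.

(* Lebesgue measure on R^n, in two steps: the n-fold product of the library's
   (Borel) Lebesgue measure on the alias [borel_rV R n] of ['rV[R]_n], then its
   completion (the restriction of its outer measure to the Caratheodory
   measurable sets).  The measurable sets of ['rV[R]_n] itself are the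
   Lebesgue-measurable ones. *)

Definition borel_rV (R : realType) (n : nat) := 'rV[R]_n.

HB.instance Definition _ (R : realType) (n : nat) :=
  Pointed.copy (borel_rV R n) 'rV[R]_n.

Section borel_rV_measurable.
Variables (R : realType) (n : nat).

Let coord (i : 'I_n) (x : borel_rV R n) : measurableTypeR R := x ord0 i.

Let borel0 : g_sigma_preimage coord set0.
Proof. exact: sigma_algebra0. Qed.

Let borelC A : g_sigma_preimage coord A -> g_sigma_preimage coord (~` A).
Proof. exact: sigma_algebraC. Qed.

Let borelU (F : (set (borel_rV R n))^nat) :
  (forall i, g_sigma_preimage coord (F i)) ->
  g_sigma_preimage coord (\bigcup_i (F i)).
Proof. exact: sigma_algebra_bigcup. Qed.

HB.instance Definition _ := @isMeasurable.Build default_measure_display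
  (borel_rV R n) (g_sigma_preimage coord) borel0 borelC borelU.

Lemma measurable_borel_coord (i : 'I_n) :
  measurable_fun setT
    (fun x : borel_rV R n => (x ord0 i : measurableTypeR R)).
Proof.
move=> _ Y mY; rewrite setTI; apply: sub_sigma_algebra => /=.
rewrite -bigcup_seq/=; exists i => /=; first by rewrite mem_index_enum.
by exists Y => //; rewrite setTI.
Qed.

Lemma measurable_fun_borel_rV d (T : measurableType d)
    (f : T -> borel_rV R n) :
  (forall i, measurable_fun setT (fun x => (f x ord0 i : measurableTypeR R))) ->
  measurable_fun setT f.
Proof.
move=> mf; apply: (@measurability _ _ _ _ _ _
  (\big[setU/set0]_(i < n) preimage_set_system setT (coord i) measurable)) => //.
move=> _ [B + <-]; rewrite -bigcup_seq => -[i _ [C mC <-]].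
by rewrite !setTI; have := mf i measurableT _ mC; rewrite setTI.
Qed.

End borel_rV_measurable.

Section product_step.
Variables (R : realType) (n : nat).

Definition vcons (z : measurableTypeR R * borel_rV R n) : borel_rV R n.+1 :=
  \row_i (if unlift ord0 i is Some j then z.2 ord0 j else z.1).

Lemma measurable_vcons : measurable_fun setT vcons.
Proof.
apply: measurable_fun_borel_rV => i; rewrite /vcons.
have [j ->|->] := unliftP ord0 i.
- rewrite (_ : (fun _ => _) =
    (fun x : borel_rV R n => (x ord0 j : measurableTypeR R)) \o snd).
    exact: measurableT_comp (@measurable_borel_coord R n j) measurable_snd.
  by apply/funext => z /=; rewrite mxE liftK.
- rewrite (_ : (fun _ => _) = fst); first exact: measurable_fst.
  by apply/funext => z /=; rewrite mxE unlift_none.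
Qed.

Variable m : {sigma_finite_measure set (borel_rV R n) -> \bar R}.

Definition borel_step : set (borel_rV R n.+1) -> \bar R :=
  pushforward (@lebesgue_measure R \x m)%E vcons.

Let borel_step0 : borel_step set0 = 0%E.
Proof. by rewrite /borel_step /pushforward preimage_set0 measure0. Qed.

Let borel_step_ge0 A : (0 <= borel_step A)%E.
Proof. by rewrite /borel_step /pushforward; exact: measure_ge0. Qed.

Let borel_step_sigma_additive : semi_sigma_additive borel_step.
Proof.
have mpre A : measurable A -> measurable (vcons @^-1` A).
  by move=> mA; rewrite -[X in measurable X]setTI; exact: measurable_vcons.
move=> F mF tF mUF; rewrite /borel_step /pushforward preimage_bigcup.
apply: measure_semi_sigma_additive.
- by move=> k; exact: mpre.
- apply/trivIsetP => /= i j _ _ ij; rewrite -preimage_setI.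
  by move/trivIsetP : tF => /(_ _ _ _ _ ij) ->//; rewrite preimage_set0.
- by rewrite -preimage_bigcup; exact: mpre.
Qed.

HB.instance Definition _ := isMeasure.Build _ _ _ borel_step
  borel_step0 borel_step_ge0 borel_step_sigma_additive.

Let borel_step_sigma_finite : sigma_finite setT borel_step.
Proof.
have [F TF mF] : sigma_finite setT (@lebesgue_measure R \x m)%E.
  have /sigma_finiteP[A [AT ndA Aoo]] := sigma_finiteT (@lebesgue_measure R).
  have /sigma_finiteP[B [BT ndB Boo]] := sigma_finiteT m.
  exists (fun k => A k `*` B k).
    rewrite -setXTT AT BT predeqE => -[x y]; split.
      move=> [/= [i _ Ai] [j _ Bj]]; exists (maxn i j) => //; split.
      - by move: x Ai; exact/subsetPset/ndA/leq_maxl.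
      - by move: y Bj; exact/subsetPset/ndB/leq_maxr.
    by move=> [k _ []/= ? ?]; split; exists k.
  move=> k; have [? ?] := Aoo k; have [? ?] := Boo k.
  split; first exact: measurableX.
  by rewrite product_measure1E// lte_mul_pinfty// ge0_fin_numE.
pose tl (x : borel_rV R n.+1) : measurableTypeR R * borel_rV R n :=
  (x ord0 ord0, \row_j x ord0 (lift ord0 j)).
have tlK z : tl (vcons z) = z.
  case: z => a v; rewrite /tl /vcons; congr pair; first by rewrite mxE unlift_none.
  by apply/rowP => j; rewrite !mxE liftK.
have mtl : measurable_fun setT tl.
  apply: measurable_fun_pair; first exact: measurable_borel_coord.
  apply: measurable_fun_borel_rV => j.
  under eq_fun do rewrite mxE.
  exact: measurable_borel_coord.
exists (fun k => tl @^-1` F k).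
  by rewrite -preimage_bigcup -TF preimage_setT.
move=> k; have [mFk Fkoo] := mF k; split.
  by rewrite -[X in measurable X]setTI; exact: mtl.
rewrite /borel_step /pushforward -comp_preimage.
by rewrite (_ : tl \o vcons = id)//; apply/funext => z; exact: tlK.
Qed.

HB.instance Definition _ :=
  Measure_isSigmaFinite.Build _ _ _ borel_step borel_step_sigma_finite.

End product_step.

Fixpoint lebesgue_borel (R : realType) (n : nat) :
    {sigma_finite_measure set (borel_rV R n) -> \bar R} :=
  match n with
  | 0 => @dirac _ (borel_rV R 0) (0 : 'rV[R]_0) R
  | n'.+1 => borel_step (lebesgue_borel R n')
  end.

Lemma lebesgue_borel_box (R : realType) (n : nat)
    (A : 'I_n -> set (measurableTypeR R)) :
  (forall i, measurable (A i)) ->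
  lebesgue_borel R n [set x : borel_rV R n | forall i, A i (x ord0 i)] =
  (\prod_(i < n) lebesgue_measure (A i))%E.
Proof.
elim: n A => [|n IHn] A mA.
  rewrite big_ord0 (_ : [set _ | _] = setT); first by rewrite /= diracT.
  by apply/seteqP; split => // x _ [].
rewrite big_ord_recl -IHn//.
pose B := [set x : borel_rV R n | forall i, A (lift ord0 i) (x ord0 i)].
transitivity ((@lebesgue_measure R \x lebesgue_borel R n)%E (A ord0 `*` B)).
  rewrite /= /borel_step /pushforward; congr (_ _).
  apply/seteqP; split => [z /= zA|z [/= z1 z2] i].
    split; first by have := zA ord0; rewrite mxE unlift_none.
    by move=> i; have := zA (lift ord0 i); rewrite mxE liftK.
  by rewrite mxE; have [j ->|->] := unliftP ord0 i; first exact: z2.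
rewrite product_measure1E//.
rewrite (_ : B = \big[setI/setT]_(i < n)
  ((fun x : borel_rV R n => (x ord0 i : measurableTypeR R)) @^-1`
     A (lift ord0 i))).
  apply: bigsetI_measurable => i _; rewrite -[X in measurable X]setTI.
  exact: measurable_borel_coord.
rewrite -bigcap_seq; apply/seteqP; split => x Bx i.
  by move=> _; exact: Bx.
by apply: Bx; rewrite /= mem_index_enum.
Qed.

(* A display of its own: with [caratheodory_display] the whole construction of
   the outer measure would occur in the type of every integral below. *)
Definition lebesgue_display : measure_display.
Proof. exact: default_measure_display. Qed.

Section lebesgue_rV.
Variables (R : realType) (n : nat).

Let outer : set (borel_rV R n) -> \bar R := (lebesgue_borel R n)^*%mu.

Let cara0 : outer.-cara.-measurable set0.
Proof. exact: measurable0. Qed.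

Let caraC (A : set 'rV[R]_n) :
  outer.-cara.-measurable A -> outer.-cara.-measurable (~` A).
Proof. exact: measurableC. Qed.

Let caraU (F : (set 'rV[R]_n)^nat) :
  (forall i, outer.-cara.-measurable (F i)) ->
  outer.-cara.-measurable (\bigcup_i F i).
Proof. exact: bigcupT_measurable. Qed.

HB.instance Definition _ := @isMeasurable.Build lebesgue_display 'rV[R]_n
  outer.-cara.-measurable cara0 caraC caraU.

Definition lebesgue_rV : set 'rV[R]_n -> \bar R := (lebesgue_borel R n)^*%mu.

Let lebesgue_rV0 : lebesgue_rV set0 = 0%E.
Proof. exact: outer_measure0. Qed.

Let lebesgue_rV_ge0 A : (0 <= lebesgue_rV A)%E.
Proof. exact: outer_measure_ge0. Qed.

Let lebesgue_rV_sigma_additive : semi_sigma_additive lebesgue_rV.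
Proof. by move=> F; exact: caratheodory_measure_sigma_additive. Qed.

HB.instance Definition _ := isMeasure.Build _ _ _ lebesgue_rV
  lebesgue_rV0 lebesgue_rV_ge0 lebesgue_rV_sigma_additive.

Let lebesgue_rV_sigma_finite : sigma_finite setT lebesgue_rV.
Proof.
have [F TF mF] := sigma_finiteT (lebesgue_borel R n).
exists F => // k; have [mFk Fkoo] := mF k; split.
  exact: caratheodory_measurable_mu_ext.
by rewrite /lebesgue_rV measurable_mu_extE.
Qed.

HB.instance Definition _ :=
  Measure_isSigmaFinite.Build _ _ _ lebesgue_rV lebesgue_rV_sigma_finite.

Lemma lebesgue_rV_complete : measure_is_complete lebesgue_rV.
Proof. exact: measure_is_complete_caratheodory. Qed.

Lemma lebesgue_rV_borel (A : set (borel_rV R n)) :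
  measurable A -> lebesgue_rV A = lebesgue_borel R n A.
Proof. exact: measurable_mu_extE. Qed.

Lemma borel_lebesgue_measurable (A : set (borel_rV R n)) :
  measurable A -> measurable (A : set 'rV[R]_n).
Proof. exact: caratheodory_measurable_mu_ext. Qed.

End lebesgue_rV.

Section fractional_p_laplacian.
Variables (R : realType) (N : nat).
Local Notation vec := 'rV[R]_N.
Local Notation mu := (@lebesgue_rV R N).

Definition dotv (x y : vec) : R := \sum_i x ord0 i * y ord0 i.

(* The library's norm on ['rV[R]_N] is the sup norm; the kernel and the
   distance to the boundary use the Euclidean one. *)
Definition enorm (x : vec) : R := Num.sqrt (dotv x x).

Definition dist_compl (Omega : set vec) (x : vec) : R :=
  inf [set enorm (x - y) | y in ~` Omega].

Definition C11 (g : vec -> R) : Prop :=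
  (forall x, differentiable g x) /\
  exists k : R, k.-lipschitz (fun x => \row_i 'D_(delta_mx ord0 i) g x).

(* [Omega] is locally the strict epigraph, in the direction of a unit vector
   [e], of a C^{1,1} function on the hyperplane orthogonal to [e];
   [y - dotv y e *: e] is the orthogonal projection of [y] on it. *)
Definition C11_boundary (Omega : set vec) : Prop :=
  forall x0, (closure Omega `\` interior Omega) x0 ->
  exists (e : vec) (g : vec -> R) (r : R),
    [/\ enorm e = 1, C11 g, 0 < r &
      forall y, enorm (y - x0) < r ->
        (Omega y <-> g (y - dotv y e *: e) < dotv y e)].

(* On the diagonal [x = y] the kernel is [0^-1 = 0]; the diagonal is negligible
   for the product measure. *)
Definition gagliardo (s p : R) (u : vec -> R) : \bar R :=
  ((\int[mu \x mu]_z
      (`|u z.1 - u z.2| `^ p / enorm (z.1 - z.2) `^ (N%:R + p * s))%:E)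
   `^ p^-1)%E.

(* Elements are functions, not classes: vanishing outside [Omega] is a.e. *)
Definition W0 (Omega : set vec) (s p : R) : set (vec -> R) :=
  [set u : vec -> R | [/\ u \in Lfun mu p%:E, (gagliardo s p u < +oo)%E &
    {ae mu, forall x, ~ Omega x -> u x = 0}]].

Definition W0_nneg (Omega : set vec) (s p : R) : set (vec -> R) :=
  [set u : vec -> R | W0 Omega s p u /\ {ae mu, forall x, 0 <= u x}].

Definition frac_pLaplacian (s p : R) (u v : vec -> R) : \bar R :=
  (\int[mu \x mu]_z
     (`|u z.1 - u z.2| `^ (p - 2) * (u z.1 - u z.2) * (v z.1 - v z.2)
      / enorm (z.1 - z.2) `^ (N%:R + p * s))%:E)%E.

Definition weak_subsolution (Omega : set vec) (s p : R) (f : vec -> R -> R)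
    (u : vec -> R) : Prop :=
  W0 Omega s p u /\
  forall phi, W0_nneg Omega s p phi ->
    (frac_pLaplacian s p u phi <= \int[mu]_(x in Omega) (f x (u x) * phi x)%:E)%E.

Definition weak_supersolution (Omega : set vec) (s p : R) (f : vec -> R -> R)
    (u : vec -> R) : Prop :=
  W0 Omega s p u /\
  forall phi, W0_nneg Omega s p phi ->
    (\int[mu]_(x in Omega) (f x (u x) * phi x)%:E <= frac_pLaplacian s p u phi)%E.

Definition caratheodory_fun (Omega : set vec) (f : vec -> R -> R) : Prop :=
  (forall t, measurable_fun Omega (f ^~ t)) /\
  {ae mu, forall x, Omega x -> continuous (f x)}.

Definition C0s (Omega : set vec) (s : R) : set (vec -> R) :=
  [set u : vec -> R | {within closure Omega, continuous u} /\
    exists g : vec -> R, {within closure Omega, continuous g} /\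
      forall x, Omega x -> g x = u x / dist_compl Omega x `^ s].

(* A positive [inf] implies that the quotients are bounded below, as [inf] is 0
   on sets without a lower bound. *)
Definition int_C0s_nneg (Omega : set vec) (s : R) : set (vec -> R) :=
  [set u : vec -> R | C0s Omega s u /\
    0 < inf [set u x / dist_compl Omega x `^ s | x in Omega]].

End fractional_p_laplacian.

(* Main.v *)
Require Import Defs.
From mathcomp Require Import all_boot all_order all_algebra.
From mathcomp Require Import all_classical all_reals all_analysis.
From mathcomp Require Import measurable_realfun ring lra.

(** The proof is a Diaz-Saa argument.  Test the inequality for the subsolution [u]
    with [phi = (u^p - v^p)^+ / u^(p-1)] and the one for the supersolution [v] with
    [psi = (u^p - v^p)^+ / v^(p-1)].  The right-hand sides become the integrals of
    [f x u / u^(p-1)] and [f x v / v^(p-1)] against the same weight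
    [(u^p - v^p)^+], and since [f x t / t^(p-1)] is strictly decreasing the first
    integrand is strictly smaller wherever [v < u].  On the other side, the energy
    terms are ordered the other way: the operator at [v] paired with [psi] is at
    most the operator at [u] paired with [phi] ([diaz_saa]).  The chain of
    inequalities closes up only if [v < u] on a null set
    ([comparison_of_integrals]).

    The order of the energy terms is a pointwise fact about the values [a], [b] of
    [u] and [c], [d] of [v] at two points ([diaz_saa_pointwise]).  If [c < a] and
    [d < b] it is the sum of two discrete Picone inequalities ([picone]), which
    express the convexity of [t^p]; if only one of them holds, it follows from
    the monotonicity of the flux [|t|^(p-2) t].

    The test functions are admissible because [u] and [v] are comparable: both lie
    between positive multiples of the power [s] of the distance to the boundary
    ([int_C0s_nneg_comparable]).  On the cone of pairs with [u <= K v] and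
    [v <= K u], [phi] and [psi] are one-homogeneous Lipschitz functions of
    [(u, v)] ([homogeneous_lipschitz]), so their increments are bounded by those
    of [u] and [v], and their energy is finite ([gagliardo_dominated]).

    Subtracting the integrals requires that they be finite.  For the energy terms
    this is Young's inequality; for the reaction terms it follows from the growth
    condition, since [u] and [v] are bounded and [Omega] has finite measure, once
    [f x (u x)] is known to be measurable ([caratheodory_comp_measurable]). *)

Import Order.TTheory GRing.Theory Num.Theory.
Import numFieldNormedType.Exports.

Local Open Scope classical_set_scope.
Local Open Scope ring_scope.

Set Implicit Arguments.
Unset Strict Implicit.

(** * Pointwise inequalities for the flux *)

Section p_flux.
Context {R : realType}.
Implicit Types a b c d p t x y : R.

Definition pflux p t : R := `|t| `^ (p - 2) * t.

Lemma pflux_ge0E p t : 1 < p -> 0 <= t -> pflux p t = t `^ (p - 1).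
Proof.
move=> p1; rewrite le_eqVlt => /predU1P[<-|t0].
  by rewrite /pflux mulr0 powR0// gt_eqF// subr_gt0.
rewrite /pflux gtr0_norm// -{2}(powRr1 (ltW t0)) -powRD.
  by congr (_ `^ _); ring.
by rewrite (gt_eqF t0) implybT.
Qed.

Lemma pfluxN p t : pflux p (- t) = - pflux p t.
Proof. by rewrite /pflux normrN mulrN. Qed.

Lemma norm_pflux p t : 1 < p -> `|pflux p t| = `|t| `^ (p - 1).
Proof.
move=> p1; rewrite -pflux_ge0E// /pflux normrM normr_id.
by rewrite ger0_norm// powR_ge0.
Qed.

Lemma pflux_mulr p t : 1 < p -> pflux p t * t = `|t| `^ p.
Proof.
move=> p1; have [t0|t0] := leP 0 t.
  by rewrite pflux_ge0E// mulrC mulr_powRB1 ?ger0_norm//; lra.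
rewrite -[in X in _ * X](opprK t) mulrN -mulNr -pfluxN.
rewrite pflux_ge0E ?oppr_ge0//; last lra.
by rewrite mulrC mulr_powRB1 ?ltr0_norm//; lra.
Qed.

Lemma ler_pflux p x y : 1 < p -> x <= y -> pflux p x <= pflux p y.
Proof.
have homo a b : 1 < p -> 0 <= a -> a <= b -> pflux p a <= pflux p b.
  move=> p1 a0 ab; have b0 := le_trans a0 ab.
  rewrite !pflux_ge0E//; apply: ge0_ler_powR; rewrite ?nnegrE//; lra.
move=> p1 xy; have [x0|x0] := leP 0 x; first exact: homo.
have [y0|y0] := leP 0 y.
  apply: (@le_trans _ _ 0).
    by rewrite /pflux mulr_ge0_le0 ?powR_ge0// ltW.
  by rewrite /pflux mulr_ge0 ?powR_ge0.
by rewrite -lerN2 -!pfluxN homo//; lra.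
Qed.

Lemma pfluxM p a t : 1 < p -> 0 < a -> pflux p (a * t) = a `^ (p - 1) * pflux p t.
Proof.
move=> p1 a0; rewrite -(pflux_ge0E p1 (ltW a0)) /pflux normrM powRM//.
ring.
Qed.

Lemma powRN1p p a : a `^ (1 - p) = (a `^ (p - 1))^-1.
Proof. by rewrite -powRN opprB. Qed.

Lemma mulr_powR1B p a : 0 < a -> a `^ p * a `^ (1 - p) = a.
Proof.
move=> a0; rewrite -powRD ?(gt_eqF a0) ?implybT//.
by rewrite addrCA subrr addr0 powRr1// ltW.
Qed.

(** Convexity of the power at the points [x / th] and [y / (1 - th)], whose
    convex combination with weights [th] and [1 - th] is [x + y]. *)
Lemma powR_split p x y th : 1 <= p -> 0 <= x -> 0 <= y -> 0 < th -> th < 1 ->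
  (x + y) `^ p <= x `^ p * th `^ (1 - p) + y `^ p * (1 - th) `^ (1 - p).
Proof.
move=> p1 x0 y0 th0 th1.
have th1' : 0 < 1 - th by lra.
have X0 : 0 <= x / th by rewrite divr_ge0// ltW.
have Y0 : 0 <= y / (1 - th) by rewrite divr_ge0// ltW.
have := convex_powR p1 (Itv01 (ltW th0) (ltW th1))
  (x := x / th) (y := y / (1 - th)).
rewrite !inE/= !in_itv/= X0 Y0 => /(_ erefl erefl).
rewrite [X in X `^ p <= _ -> _]convRE [X in _ <= X -> _]convRE/= /unstable.onem.
have -> : th * (x / th) + (1 - th) * (y / (1 - th)) = x + y.
  by field; rewrite !gt_eqF.
have E z w : 0 <= z -> 0 < w -> w * (z / w) `^ p = z `^ p * w `^ (1 - p).
  move=> z0 w0; rewrite powRM// ?invr_ge0 ?ltW// mulrCA; congr (_ * _).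
  rewrite -powR_inv1 ?ltW// -powRrM -{1}(powRr1 (ltW w0)) -powRD.
    by congr (_ `^ _); ring.
  by rewrite (gt_eqF w0) implybT.
by rewrite !E.
Qed.

(** The discrete Picone inequality.  For [b < a] and [th = (a - b) / a], the
    coefficient of [c^p] is [th^(p-1)] and that of [d^p] is
    [- (th / (1 - th))^(p-1)], so that this is the convexity bound [powR_split],
    multiplied by [th^(p-1)], for [c <= `|c - d| + d]. *)
Lemma picone p a b c d : 1 < p -> 0 < a -> 0 < b -> 0 <= c -> 0 <= d ->
  pflux p (a - b) * (c `^ p * a `^ (1 - p) - d `^ p * b `^ (1 - p)) <=
  `|c - d| `^ p.
Proof.
wlog ba : a b c d / b <= a.
  move=> H p1 a0 b0 c0 d0; have [/H|/ltW/H] := leP b a; first exact.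
  move=> /(_ d c p1 b0 a0 d0 c0); rewrite -[b - a]opprB pfluxN distrC.
  by rewrite mulNr -mulrN opprB.
move=> p1 a0 b0 c0 d0; have p10 : 0 < p - 1 by lra.
move: ba; rewrite le_eqVlt => /predU1P[->|ba].
  by rewrite subrr /pflux mulr0 mul0r powR_ge0.
pose th := (a - b) / a.
have th0 : 0 < th by rewrite divr_gt0// subr_gt0.
have th1 : th < 1 by rewrite /th ltr_pdivrMr// mul1r; lra.
have th1E : 1 - th = b / a by rewrite /th; field; rewrite gt_eqF.
have cd_conv : c `^ p <= (`|c - d| + d) `^ p.
  apply: ge0_ler_powR; rewrite ?nnegrE ?addr_ge0//; first lra.
  by rewrite -lerBlDr ler_norm.
have := le_trans cd_conv (powR_split (ltW p1) (normr_ge0 (c - d)) d0 th0 th1).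
rewrite th1E -(ler_pM2l (powR_gt0 (p - 1) th0)) mulrDr.
have thK x : 0 < x -> x `^ (p - 1) * x `^ (1 - p) = 1.
  by move=> x_gt0; rewrite powRN1p mulfV// gt_eqF// powR_gt0.
rewrite mulrCA thK// mulr1 -lerBlDr => H; apply: le_trans H.
rewrite pflux_ge0E ?subr_ge0//; last lra.
have -> : a - b = th * a by rewrite /th divfK// gt_eqF.
have [[a0' b0'] th0'] := (ltW a0, ltW b0, ltW th0).
have -> : (b / a) `^ (1 - p) = b `^ (1 - p) * a `^ (p - 1).
  rewrite powRM ?invr_ge0//; congr (_ * _).
  by rewrite -powR_inv1// -powRrM; congr (_ `^ _); ring.
rewrite powRM//.
rewrite le_eqVlt; apply/orP; left; apply/eqP.
rewrite mulrBr; congr (_ - _); last by ring.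
by rewrite -mulrA; congr (_ * _); rewrite mulrCA thK// mulr1.
Qed.

(** By homogeneity of the flux the two sides are its values at [1 - d / c] and
    [1 - b / a], and [b / a <= d / c]. *)
Lemma pflux_quotient_le p a b c d :
  1 < p -> 0 < c -> c <= a -> 0 <= b -> b <= d ->
  pflux p (c - d) * c `^ (1 - p) <= pflux p (a - b) * a `^ (1 - p).
Proof.
move=> p1 c0 ca b0 bd; have a0 := lt_le_trans c0 ca.
have scale x y : 0 < x -> pflux p (x - y) * x `^ (1 - p) = pflux p (1 - y / x).
  move=> x0; have -> : x - y = x * (1 - y / x) by field; rewrite gt_eqF.
  rewrite pfluxM// powRN1p mulrAC mulfV ?mul1r//.
  by rewrite gt_eqF// powR_gt0.
rewrite !scale//; apply: ler_pflux => //; rewrite lerD2l lerN2.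
by rewrite ler_pdivrMr// mulrAC ler_pdivlMr// ler_pM// ltW.
Qed.

Definition ppow_excess p a c : R := Num.max (a `^ p - c `^ p) 0.

Lemma ppow_excess_ge0 p a c : 0 <= ppow_excess p a c.
Proof. by rewrite le_max lexx orbT. Qed.

Lemma ppow_excess_le p a c : 0 <= p -> 0 <= a -> a <= c -> ppow_excess p a c = 0.
Proof.
move=> p0 a0 ac; apply/max_idPr; rewrite subr_le0.
by apply: ge0_ler_powR; rewrite ?nnegrE// (le_trans a0).
Qed.

Lemma ppow_excess_ge p a c : 0 <= p -> 0 <= c -> c <= a ->
  ppow_excess p a c = a `^ p - c `^ p.
Proof.
move=> p0 c0 ca; apply/max_idPl; rewrite subr_ge0.
by apply: ge0_ler_powR; rewrite ?nnegrE// (le_trans c0).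
Qed.

Lemma ppow_excess_gt0 p a c : 0 < p -> 0 <= c -> c < a -> 0 < ppow_excess p a c.
Proof.
move=> p0 c0 ca; rewrite lt_max subr_gt0 gt0_ltr_powR ?nnegrE//.
by rewrite (le_trans c0)// ltW.
Qed.

(** The values that a pair of positive functions vanishing outside the domain
    takes almost everywhere; the second case is the exterior. *)
Definition both_pos_or_zero (a c : R) : Prop :=
  (0 < a /\ 0 < c) \/ (a = 0 /\ c = 0).

(** The Diaz-Saa inequality before integration.  Where both excesses are
    positive it is the sum of two Picone inequalities; where only one is, it is
    [pflux_quotient_le]. *)
Lemma diaz_saa_pointwise p a b c d : 1 < p ->
  both_pos_or_zero a c -> both_pos_or_zero b d ->
  pflux p (c - d) *
    (ppow_excess p a c * c `^ (1 - p) - ppow_excess p b d * d `^ (1 - p)) <=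
  pflux p (a - b) *
    (ppow_excess p a c * a `^ (1 - p) - ppow_excess p b d * b `^ (1 - p)).
Proof.
move=> p1 ac bd; have p0 : 0 <= p by lra.
have ge0 x y : both_pos_or_zero x y -> 0 <= x /\ 0 <= y.
  by case=> [[x0 y0]|[-> ->]] //; rewrite !ltW.
have [[a0 c0] [b0 d0]] := (ge0 _ _ ac, ge0 _ _ bd).
have one_sided x y z w : both_pos_or_zero x z -> z < x -> 0 <= y -> y <= w ->
    pflux p (z - w) * (ppow_excess p x z * z `^ (1 - p)) <=
    pflux p (x - y) * (ppow_excess p x z * x `^ (1 - p)).
  move=> [[x0 z0]|[-> ->]]; last by rewrite ltxx.
  move=> zx y0 yw; rewrite ![_ * (ppow_excess _ _ _ * _)]mulrCA.
  rewrite ler_wpM2l ?ppow_excess_ge0//.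
  by apply: pflux_quotient_le => //; exact: ltW.
have [a_le_c|c_lt_a] := leP a c; have [b_le_d|d_lt_b] := leP b d.
- by rewrite !ppow_excess_le// !mul0r subrr !mulr0.
- rewrite (ppow_excess_le p0 a0 a_le_c) !mul0r !sub0r.
  have := one_sided _ _ _ _ bd d_lt_b a0 a_le_c.
  by rewrite -(opprB a b) -(opprB c d) !pfluxN; lra.
- by rewrite (ppow_excess_le p0 b0 b_le_d) !mul0r !subr0 one_sided.
have [a_gt0 b_gt0] : 0 < a /\ 0 < b.
  by split; [exact: le_lt_trans c_lt_a|exact: le_lt_trans d_lt_b].
have c_gt0 : 0 < c by case: ac => [[]//|[a0']]; rewrite a0' ltxx in a_gt0.
have d_gt0 : 0 < d by case: bd => [[]//|[b0']]; rewrite b0' ltxx in b_gt0.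
rewrite !ppow_excess_ge ?(ltW c_lt_a) ?(ltW d_lt_b)// !mulrBl !mulr_powR1B//.
have := picone p1 a_gt0 b_gt0 c0 d0; have := picone p1 c_gt0 d_gt0 a0 b0.
have := pflux_mulr (a - b) p1; have := pflux_mulr (c - d) p1.
lra.
Qed.

End p_flux.

(** * Lipschitz estimates for the test functions *)

Section test_functions.
Context {R : realType}.
Implicit Types a b c d p t x y K : R.

(** The tangent-line bound for [t^p], read off Young's inequality
    [y * x^(p-1) <= y^p / p + x^p / q]. *)
Lemma powRB_le p x y : 1 < p -> 0 <= x -> 0 <= y ->
  x `^ p - y `^ p <= p * x `^ (p - 1) * (x - y).
Proof.
move=> p1 x0 y0; have p0 : 0 < p by lra.
have p10 : 0 < p - 1 by lra.
have q0 : 0 < p / (p - 1) by rewrite divr_gt0.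
have pq : p^-1 + (p / (p - 1))^-1 = 1 by field; rewrite !gt_eqF.
have := conjugate_powR y0 (powR_ge0 x (p - 1)) p0 q0 pq.
rewrite -powRrM mulrC (_ : (p - 1) * (p / (p - 1)) = p); last first.
  by field; rewrite gt_eqF.
rewrite -(ler_pM2l p0) mulrDr (_ : p * (y `^ p / p) = y `^ p); last first.
  by field; rewrite gt_eqF.
rewrite (_ : p * (x `^ p / (p / (p - 1))) = (p - 1) * x `^ p); last first.
  by field; rewrite !gt_eqF.
have := mulr_powRB1 x0 p0; rewrite mulrC; set X := x `^ (p - 1).
move=> <-; lra.
Qed.

Lemma powR_lipschitz p K x y : 1 < p -> 0 <= x <= K -> 0 <= y <= K ->
  `|x `^ p - y `^ p| <= p * K `^ (p - 1) * `|x - y|.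
Proof.
move=> p1; wlog yx : x y / y <= x.
  move=> H hx hy; have [/H|/ltW/H] := leP y x; first exact.
  by rewrite distrC (distrC x); apply.
move=> /andP[x0 xK] /andP[y0 yK].
have K0 := le_trans x0 xK.
rewrite ger0_norm; last by rewrite subr_ge0 ge0_ler_powR ?nnegrE//; lra.
rewrite ger0_norm ?subr_ge0//; apply: le_trans (powRB_le p1 x0 y0) _.
rewrite ler_wpM2r ?subr_ge0// ler_wpM2l//; first lra.
by rewrite ge0_ler_powR ?nnegrE//; lra.
Qed.

Lemma ler_dist_max0 x y : `|Num.max x 0 - Num.max y 0| <= `|x - y|.
Proof.
rewrite ler_norml; have := ler_norm (x - y); have := ler_norm (y - x).
rewrite (distrC y) /Num.max => *.
by do 2 case: ifPn; rewrite -?leNgt => *; apply/andP; split; lra.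
Qed.

Lemma ppow_excessZ p a c e : 0 < e -> 0 <= a -> 0 <= c ->
  ppow_excess p a c * e `^ (1 - p) = e * ppow_excess p (a / e) (c / e).
Proof.
move=> e_gt0 a0 c0; have e0 := ltW e_gt0.
have E x : 0 <= x -> x `^ p * e `^ (1 - p) = e * (x / e) `^ p.
  move=> x0; rewrite powRM ?invr_ge0// mulrCA; congr (_ * _).
  rewrite -powR_inv1// -powRrM -[in RHS](powRr1 e0) -powRrM -powRD.
    by congr (_ `^ _); ring.
  by rewrite (gt_eqF e_gt0) implybT.
rewrite /ppow_excess maxr_pMl ?powR_ge0// maxr_pMr// mul0r mulr0.
by rewrite mulrBl mulrBr !E.
Qed.

(** A one-homogeneous function [c * h (a / c)] of two variables is Lipschitz on
    a cone on which the slope [a / c] is bounded. *)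
Lemma homogeneous_lipschitz (h : R -> R) (K B L : R) (a b c d : R) :
  0 <= K -> 0 <= L ->
  (forall t, 0 <= t <= K -> `|h t| <= B) ->
  (forall t t', 0 <= t <= K -> 0 <= t' <= K -> `|h t - h t'| <= L * `|t - t'|) ->
  0 < c -> 0 < d -> 0 <= a <= K * c -> 0 <= b <= K * d ->
  `|c * h (a / c) - d * h (b / d)| <= (B + L * (1 + K)) * (`|a - b| + `|c - d|).
Proof.
move=> K0 L0 hB hL c0 d0 /andP[a0 aK] /andP[b0 bK].
have acK : 0 <= a / c <= K by rewrite divr_ge0 ?(ltW c0)//= ler_pdivrMr.
have bdK : 0 <= b / d <= K by rewrite divr_ge0 ?(ltW d0)//= ler_pdivrMr.
have B0 : 0 <= B by apply: le_trans (hB _ acK).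
have -> : c * h (a / c) - d * h (b / d) =
  (c - d) * h (b / d) + c * (h (a / c) - h (b / d)) by ring.
have slope : c * `|a / c - b / d| <= (1 + K) * (`|a - b| + `|c - d|).
  rewrite -[X in X * _](ger0_norm (ltW c0)) -normrM.
  have -> : c * (a / c - b / d) = (a - b) + (b / d) * (d - c).
    by field; rewrite ?(gt_eqF c0) ?(gt_eqF d0).
  apply: le_trans (ler_normD _ _) _; rewrite normrM (distrC d).
  have /andP[bd0 bd1] := bdK; rewrite (ger0_norm bd0).
  have := ler_wpM2r (normr_ge0 (c - d)) bd1.
  have := normr_ge0 (a - b); have := normr_ge0 (c - d).
  have := mulr_ge0 K0 (normr_ge0 (a - b)).
  lra.
apply: le_trans (ler_normD _ _) _; rewrite !normrM (ger0_norm (ltW c0)).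
have H1 := ler_wpM2l (normr_ge0 (c - d)) (hB _ bdK).
have H2 := ler_wpM2l (ltW c0) (hL _ _ acK bdK).
have H3 := ler_wpM2l L0 slope.
have H4 := mulr_ge0 B0 (normr_ge0 (a - b)).
lra.
Qed.

(** Bounds on both quotients [a / c] and [c / a], without division so that the
    exterior value [(0, 0)] is included. *)
Definition comparable_pair K a c : Prop :=
  [/\ both_pos_or_zero a c, a <= K * c & c <= K * a].

(** The constant [B + L (1 + K)] of [homogeneous_lipschitz] for the bound
    [B = K^p + 1] and the Lipschitz constant [L = p K^(p-1)] of [t^p - 1] on
    the interval from [0] to [K]. *)
Definition test_lip p K : R := K `^ p + 1 + p * K `^ (p - 1) * (1 + K).

Lemma test_lip_ge0 p K : 0 <= p -> 0 <= K -> 0 <= test_lip p K.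
Proof.
by move=> p0 K0; rewrite !addr_ge0 ?mulr_ge0 ?powR_ge0// addr_ge0.
Qed.

Let cone_lipschitz (h : R -> R) p K a b c d : 1 < p -> 0 <= K ->
  (forall t, 0 <= t <= K -> `|h t| <= K `^ p + 1) ->
  (forall t t', 0 <= t <= K -> 0 <= t' <= K ->
     `|h t - h t'| <= p * K `^ (p - 1) * `|t - t'|) ->
  both_pos_or_zero a c -> both_pos_or_zero b d -> a <= K * c -> b <= K * d ->
  `|c * h (a / c) - d * h (b / d)| <=
    test_lip p K * (`|a - b| + `|c - d|).
Proof.
move=> p1 K0 hB hL ac bd aK bK.
have p0 : 0 <= p by lra.
set C := test_lip p K.
have L0 : 0 <= p * K `^ (p - 1) by rewrite mulr_ge0 ?powR_ge0.
have BC : K `^ p + 1 <= C by rewrite lerDl mulr_ge0// addr_ge0.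
have C0 : 0 <= C by apply: le_trans BC; rewrite addr_ge0 ?powR_ge0.
have at0 x y : 0 < x -> 0 < y -> x <= K * y ->
    `|y * h (x / y)| <= C * (`|x| + `|y|).
  move=> x0 y0 xy; rewrite normrM mulrC ler_pM//; last by rewrite lerDr.
  by apply: le_trans (hB _ _) BC; rewrite divr_ge0 ?(ltW x0) ?(ltW y0)//= ler_pdivrMr.
case: ac aK => [[a0 c0]|[-> ->]]; case: bd bK => [[b0 d0]|[-> ->]] bK aK.
- by apply: homogeneous_lipschitz => //; rewrite ?(ltW a0) ?(ltW b0).
- by rewrite mul0r !subr0 at0.
- by rewrite mul0r !sub0r !normrN at0.
- by rewrite !mul0r subrr normr0 mulr_ge0// addr_ge0.
Qed.

Let le1_powRD p t K : 0 <= p -> 0 <= t <= K -> t `^ p <= K `^ p.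
Proof.
by move=> p0 /andP[t0 tK]; rewrite ge0_ler_powR ?nnegrE// (le_trans t0).
Qed.

(** The test function for the supersolution is [c * h (a / c)] with
    [h t = (t^p - 1)^+]. *)
Lemma test_sup_lipschitz p K a b c d : 1 < p -> 0 <= K ->
  comparable_pair K a c -> comparable_pair K b d ->
  `|ppow_excess p a c * c `^ (1 - p) - ppow_excess p b d * d `^ (1 - p)| <=
    test_lip p K * (`|a - b| + `|c - d|).
Proof.
move=> p1 K0 [ac aK _] [bd bK _]; have p0 : 0 <= p by lra.
have E x y : both_pos_or_zero x y ->
    ppow_excess p x y * y `^ (1 - p) = y * ppow_excess p (x / y) 1.
  case=> [[x0 y0]|[-> ->]]; last by rewrite ppow_excess_le// !mul0r.
  by rewrite ppow_excessZ ?(ltW x0) ?(ltW y0)// divff// gt_eqF.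
rewrite !E//; apply: (cone_lipschitz (h := fun t => ppow_excess p t 1) p1 K0 _ _
  ac bd aK bK) => [t tK|t t' tK t'K].
- rewrite ger0_norm ?ppow_excess_ge0// ge_max powR1 addr_ge0 ?powR_ge0//.
  have := le1_powRD p0 tK; lra.
- apply: le_trans (ler_dist_max0 _ _) _.
  rewrite powR1 (_ : _ - _ = t `^ p - t' `^ p); last by ring.
  exact: powR_lipschitz.
Qed.

(** The test function for the subsolution is [a * h (c / a)] with
    [h t = (1 - t^p)^+]. *)
Lemma test_sub_lipschitz p K a b c d : 1 < p -> 0 <= K ->
  comparable_pair K a c -> comparable_pair K b d ->
  `|ppow_excess p a c * a `^ (1 - p) - ppow_excess p b d * b `^ (1 - p)| <=
    test_lip p K * (`|a - b| + `|c - d|).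
Proof.
move=> p1 K0 [ac _ cK] [bd _ dK]; have p0 : 0 <= p by lra.
have E x y : both_pos_or_zero x y ->
    ppow_excess p x y * x `^ (1 - p) = x * ppow_excess p 1 (y / x).
  case=> [[x0 y0]|[-> ->]]; last by rewrite ppow_excess_le// !mul0r.
  by rewrite ppow_excessZ ?(ltW x0) ?(ltW y0)// divff// gt_eqF.
have swap x y : both_pos_or_zero x y -> both_pos_or_zero y x.
  by case=> -[]; [left|right].
rewrite !E// (addrC `|a - b|).
apply: (cone_lipschitz (h := ppow_excess p 1) p1 K0 _ _
  (swap _ _ ac) (swap _ _ bd) cK dK)
  => [t tK|t t' tK t'K].
- rewrite ger0_norm ?ppow_excess_ge0// ge_max powR1 addr_ge0 ?powR_ge0// andbT.
  have := powR_ge0 t p; have := powR_ge0 K p; lra.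
- apply: le_trans (ler_dist_max0 _ _) _.
  rewrite powR1 (_ : _ - _ = t' `^ p - t `^ p); last by ring.
  by rewrite distrC powR_lipschitz.
Qed.

Lemma powRD_le p x y : 0 <= p -> 0 <= x -> 0 <= y ->
  (x + y) `^ p <= 2 `^ p * (x `^ p + y `^ p).
Proof.
move=> p0; wlog yx : x y / y <= x.
  move=> H x0 y0; have [/H|/ltW/H] := leP y x; first exact.
  by rewrite addrC (addrC (x `^ p)); apply.
move=> x0 y0; apply: (@le_trans _ _ ((2 * x) `^ p)).
  by rewrite ge0_ler_powR ?nnegrE ?mulr_ge0 ?addr_ge0//; lra.
by rewrite powRM// ler_wpM2l ?powR_ge0// lerDl powR_ge0.
Qed.

Lemma pfluxM_le p (t w : R) : 1 < p -> `|pflux p t * w| <= `|t| `^ p + `|w| `^ p.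
Proof.
move=> p1; have p0 : 0 < p by lra.
rewrite normrM norm_pflux//.
have le_pow x y : 0 <= x -> x <= y -> x `^ (p - 1) <= y `^ (p - 1).
  by move=> x0 xy; rewrite ge0_ler_powR ?nnegrE// ?(le_trans x0 xy)//; lra.
have [tw|/ltW wt] := leP `|t| `|w|.
  apply: (@le_trans _ _ (`|w| `^ p)); last by rewrite lerDr powR_ge0.
  by rewrite -[leRHS]mulr_powRB1// mulrC ler_wpM2l// le_pow.
apply: (@le_trans _ _ (`|t| `^ p)); last by rewrite lerDl powR_ge0.
by rewrite -[leRHS]mulr_powRB1// mulrC ler_wpM2r// powR_ge0.
Qed.

Lemma test_powR_le p (C x y z : R) : 1 < p -> 0 <= C -> `|x| <= C * (`|y| + `|z|) ->
  `|x| `^ p <= (C * 2) `^ p * (`|y| `^ p + `|z| `^ p).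
Proof.
move=> p1 C0 xyz; have p0 : 0 <= p by lra.
apply: (@le_trans _ _ ((C * (`|y| + `|z|)) `^ p)).
  by rewrite ge0_ler_powR ?nnegrE// mulr_ge0// addr_ge0.
by rewrite !powRM ?addr_ge0// -mulrA ler_wpM2l ?powR_ge0// powRD_le.
Qed.

End test_functions.

(** * Almost everywhere inequalities, integrals and measurability *)

Section almost_everywhere.
Context {R : realType}.

Lemma ae_dominated_integral_lty d (T : measurableType d)
    (nu : {measure set T -> \bar R}) (F G H : T -> R) (k : R) :
  0 <= k -> measurable_fun setT F -> measurable_fun setT G ->
  measurable_fun setT H ->
  (forall x, 0 <= F x) -> (forall x, 0 <= G x) -> (forall x, 0 <= H x) ->
  {ae nu, forall x, F x <= k * (G x + H x)} ->
  (\int[nu]_x (G x)%:E < +oo)%E -> (\int[nu]_x (H x)%:E < +oo)%E ->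
  (\int[nu]_x (F x)%:E < +oo)%E.
Proof.
move=> k0 mF mG mH F0 G0 H0 FGH Goo Hoo.
apply: (@le_lt_trans _ _ (\int[nu]_x (k%:E * ((G x)%:E + (H x)%:E)))%E).
  apply: ae_ge0_le_integral => //.
  - by move=> x _; rewrite lee_fin.
  - exact/measurable_EFinP.
  - by move=> x _; rewrite -EFinD -EFinM lee_fin mulr_ge0// addr_ge0.
  - apply: emeasurable_funM => //; apply: emeasurable_funD; exact/measurable_EFinP.
  - by apply: filterS FGH => x Fx _; rewrite -EFinD -EFinM lee_fin.
rewrite ge0_integralZl//; last 2 first.
  - by apply: emeasurable_funD; exact/measurable_EFinP.
  - by move=> x _; rewrite -EFinD lee_fin addr_ge0.
rewrite ge0_integralD//; [|by move=> x _; rewrite lee_fin|exact/measurable_EFinP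
  |by move=> x _; rewrite lee_fin|exact/measurable_EFinP].
by apply: lte_mul_pinfty; rewrite ?lee_fin// lte_add_pinfty.
Qed.

Let posdiff T (f g : T -> R) (x : T) : R := Num.max (g x - f x) 0.

Let integral_posdiff d (T : measurableType d) (nu : {measure set T -> \bar R})
    (D : set T) (f g : T -> R) : measurable D ->
  nu.-integrable D (EFin \o f) -> nu.-integrable D (EFin \o g) ->
  {ae nu, forall x, D x -> f x <= g x} ->
  (\int[nu]_(x in D) (posdiff f g x)%:E =
   \int[nu]_(x in D) (g x)%:E - \int[nu]_(x in D) (f x)%:E)%E.
Proof.
move=> mD fi gi fg; rewrite -(integralB mD gi fi).
have mf := measurable_int _ fi; have mg := measurable_int _ gi.
apply: ae_eq_integral => //.
- apply/measurable_EFinP; apply: measurable_maxr => //.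
  by apply: measurable_funB; exact/measurable_EFinP.
- exact: emeasurable_funB.
apply: filterS fg => x fgx /fgx {}fgx /=.
by rewrite /posdiff -EFinB; congr EFin; apply/max_idPl; rewrite subr_ge0.
Qed.

Lemma ae_le_integral d (T : measurableType d) (nu : {measure set T -> \bar R})
    (D : set T) (f g : T -> R) : measurable D ->
  nu.-integrable D (EFin \o f) -> nu.-integrable D (EFin \o g) ->
  {ae nu, forall x, D x -> f x <= g x} ->
  (\int[nu]_(x in D) (f x)%:E <= \int[nu]_(x in D) (g x)%:E)%E.
Proof.
move=> mD fi gi fg; rewrite -sube_ge0; last first.
  by rewrite (integrable_fin_num mD fi).
rewrite -(integral_posdiff mD fi gi fg); apply: integral_ge0 => x _.
by rewrite lee_fin le_max lexx orbT.
Qed.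

(** The positive part of [g - f] has integral at most zero. *)
Lemma ae_le_integral_eq d (T : measurableType d) (nu : {measure set T -> \bar R})
    (D : set T) (f g : T -> R) : measurable D ->
  nu.-integrable D (EFin \o f) -> nu.-integrable D (EFin \o g) ->
  {ae nu, forall x, D x -> f x <= g x} ->
  (\int[nu]_(x in D) (g x)%:E <= \int[nu]_(x in D) (f x)%:E)%E ->
  {ae nu, forall x, D x -> f x = g x}.
Proof.
move=> mD fi gi fg gf.
have mh : measurable_fun D (EFin \o posdiff f g).
  apply/measurable_EFinP; apply: measurable_maxr => //.
  by apply: measurable_funB; apply/measurable_EFinP; exact: (measurable_int nu).
have h0 x : 0 <= posdiff f g x by rewrite le_max lexx orbT.
have /(ae_eq_integral_abs nu mD mh) h_eq0 :
    (\int[nu]_(x in D) `|(EFin \o posdiff f g) x|)%E = 0%E.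
  under eq_integral => x _ do rewrite gee0_abs ?lee_fin ?h0//.
  apply/eqP; rewrite eq_le integral_ge0 ?andbT; last by move=> x _; rewrite lee_fin h0.
  by rewrite /= (integral_posdiff mD fi gi fg) sube_le0.
apply: filterS2 fg h_eq0 => x fgx hx Dx; have := hx Dx; have := fgx Dx.
rewrite /posdiff /= => {}fgx -[]; rewrite (max_idPl _) ?subr_ge0// => /eqP.
by rewrite subr_eq0 => /eqP.
Qed.

Lemma ae_prod d1 d2 (T1 : measurableType d1) (T2 : measurableType d2)
    (m1 : {sigma_finite_measure set T1 -> \bar R})
    (m2 : {sigma_finite_measure set T2 -> \bar R}) (P : T1 -> Prop) (Q : T2 -> Prop) :
  {ae m1, forall x, P x} -> {ae m2, forall y, Q y} ->
  {ae (m1 \x m2)%E, forall z, P z.1 /\ Q z.2}.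
Proof.
move=> [A [mA A0 PA]] [B [mB B0 QB]].
have nA : (m1 \x m2)%E.-negligible (A `*` setT).
  exists (A `*` setT); split => //; first exact: measurableX.
  by rewrite product_measure1E//; apply/eqP; rewrite mule_eq0; apply/orP; left; apply/eqP.
have nB : (m1 \x m2)%E.-negligible (setT `*` B).
  exists (setT `*` B); split => //; first exact: measurableX.
  by rewrite product_measure1E//; apply/eqP; rewrite mule_eq0; apply/orP; right; apply/eqP.
apply: negligibleS (negligibleU nA nB) => z /= /not_andP[Pz|Qz].
- by left; split => //; exact: PA.
- by right; split => //; exact: QB.
Qed.

(** Composition with a Caratheodory function: [u] is approximated by the
    functions [floor (n u) / n], which take countably many values.  Completeness
    of the measure handles the points where [f x] is discontinuous. *)
Lemma caratheodory_comp_measurable d (T : measurableType d)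
    (nu : {measure set T -> \bar R}) (D : set T) (f : T -> R -> R) (u : T -> R) :
  measure_is_complete nu -> measurable D ->
  (forall t, measurable_fun D (f ^~ t)) ->
  {ae nu, forall x, D x -> continuous (f x)} ->
  measurable_fun D u -> measurable_fun D (fun x => f x (u x)).
Proof.
move=> nuC mD mf [A [mA A0 contA]] mu_.
(* [n.+1] in place of [n], to divide by a nonzero integer *)
pose q (n : nat) (t : R) : R := (Num.floor (n.+1%:R * t))%:~R / n.+1%:R.
have mfq n : measurable_fun D (fun x => f x (q n (u x))).
  move=> _ Y mY.
  have -> : D `&` (fun x => f x (q n (u x))) @^-1` Y =
    \bigcup_(k in [set: int])
      ((D `&` u @^-1` `[k%:~R / n.+1%:R, (k + 1)%:~R / n.+1%:R[%classic) `&`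
       (D `&` (f ^~ (k%:~R / n.+1%:R)) @^-1` Y)).
    have qE x k : q n (u x) = k%:~R / n.+1%:R <->
        `[k%:~R / n.+1%:R, (k + 1)%:~R / n.+1%:R[%classic (u x).
      rewrite /= in_itv/= ler_pdivrMr// ltr_pdivlMr// [u x * _]mulrC -floor_eq.
      split=> [/(mulIf _) E|/eqP <-//]; apply/eqP; apply: (@intr_inj R).
      by apply: E; rewrite invr_neq0.
    apply/seteqP; split=> [x [Dx Yx]|x [k _ [[Dx /qE ux] [_ Yx]]]].
      exists (Num.floor (n.+1%:R * u x)) => //.
      by split; split => //; exact/qE.
    by split => //=; rewrite ux.
  apply: countable_bigcupT_measurable => [//|k].
  by apply: measurableI; [exact: mu_|exact: mf].
have q_cvg (t : R) : q n t @[n --> \oo] --> t.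
  apply/cvgrPdist_le => e e0; near=> n.
  have n0 : 0 < n.+1%:R :> R by [].
  have /andP[h1 h2] := floor_itv (n.+1%:R * t).
  have -> : t - q n t = (n.+1%:R * t - (Num.floor (n.+1%:R * t))%:~R) / n.+1%:R.
    by rewrite /q; field; rewrite gt_eqF.
  rewrite ger0_norm; last by rewrite divr_ge0// subr_ge0.
  apply: (@le_trans _ _ n.+1%:R^-1).
    rewrite ler_pdivrMr// mulVf ?gt_eqF//; rewrite intrD in h2; lra.
  by apply: ltW; near: n; exact: near_infty_natSinv_lt (PosNum e0).
have mDA : measurable (D `\` A) by exact: measurableD.
have mlim : measurable_fun (D `\` A) (fun x => f x (u x)).
  apply: (@measurable_fun_cvg _ _ _ _ (fun n x => f x (q n (u x)))) => [n|x [Dx Ax]].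
    exact: measurable_funS (mfq n).
  have cx : continuous (f x) by apply: contrapT => nc; apply: Ax; apply: contA => /(_ Dx).
  exact: cvg_comp (q_cvg _) (cx _).
rewrite -(setDUK (@subIsetl _ D A)) setDIr setDv set0U setUC.
apply/(measurable_funU _ mDA); first exact: measurableI.
split=> // _ Y mY; apply: nuC; exists A; split => //.
by move=> x [[]].
Unshelve. all: by end_near.
Qed.

End almost_everywhere.

(** * Lebesgue measure and the Gagliardo energy *)

Section lebesgue_rV_facts.
Context {R : realType} {N : nat}.
Local Notation vec := 'rV[R]_N.
Local Notation mu := (@lebesgue_rV R N).

Lemma measurable_coord (i : 'I_N) :
  measurable_fun setT (fun x : vec => x ord0 i : R).
Proof.
move=> _ Y mY; apply: borel_lebesgue_measurable.
exact: (@measurable_borel_coord R N i).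
Qed.

(** A bounded set lies in a cube, the product of [N] compact intervals. *)
Lemma bounded_set_lebesgue_lty (A : set vec) :
  measurable A -> bounded_set A -> (mu A < +oo)%E.
Proof.
move=> mA [M [_ bA]].
have {}bA x : A x -> `|x| <= M + 1 by apply: bA; rewrite ltrDl.
pose I : set (measurableTypeR R) := `[- (M + 1), M + 1]%classic.
have mI : measurable I by exact: measurable_itv.
pose B : set (borel_rV R N) := [set x | forall i, I (x ord0 i)].
have AB : A `<=` (B : set vec).
  move=> x /bA xM i; rewrite /I /= in_itv/= -ler_norml.
  apply: le_trans xM; rewrite [leRHS]/Num.norm/= mx_normrE.
  by apply/bigmax_geP; right => /=; exists (ord0, i).
have mB : measurable B.
  rewrite (_ : B = \big[setI/setT]_(i < N)
      ((fun x : borel_rV R N => (x ord0 i : measurableTypeR R)) @^-1` I)).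
    apply: bigsetI_measurable => i _; rewrite -[X in measurable X]setTI.
    exact: measurable_borel_coord.
  rewrite -bigcap_seq; apply/seteqP; split => x Bx i; first by move=> _; exact: Bx.
  by apply: Bx; rewrite /= mem_index_enum.
apply: (@le_lt_trans _ _ (mu (B : set vec))).
  by apply: le_measure; rewrite ?inE//; exact: borel_lebesgue_measurable.
rewrite lebesgue_rV_borel// (lebesgue_borel_box (A := fun=> I))//.
rewrite ltey_eq prode_fin_num// => i _.
by rewrite ge0_fin_numE//; apply: compact_finite_measure; exact: segment_compact.
Qed.

End lebesgue_rV_facts.

Section energy.
Context {R : realType} {N : nat}.
Context (s p : R) (p_gt1 : 1 < p).
Local Notation vec := 'rV[R]_N.
Local Notation mu := (@lebesgue_rV R N).
Implicit Types u v w : vec -> R.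

Definition frac_kernel (z : vec * vec) : R :=
  (enorm (z.1 - z.2) `^ (N%:R + p * s))^-1.

Lemma frac_kernel_ge0 z : 0 <= frac_kernel z.
Proof. by rewrite invr_ge0 powR_ge0. Qed.

Lemma measurable_frac_kernel : measurable_fun setT frac_kernel.
Proof.
have -> : frac_kernel = fun z =>
    (dotv (z.1 - z.2) (z.1 - z.2) `^ 2^-1) `^ - (N%:R + p * s).
  apply/funext => z; rewrite /frac_kernel powRN powR12_sqrt//.
  by apply: sumr_ge0 => i _; exact: sqr_ge0.
do 2 apply: (measurableT_comp (measurable_powR _)).
apply: measurable_sum => i.
have mi : measurable_fun setT (fun z : vec * vec => (z.1 - z.2) ord0 i).
  under eq_fun do rewrite !mxE.
  apply: measurable_funB.
  - exact: (measurableT_comp (measurable_coord i) measurable_fst).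
  - exact: (measurableT_comp (measurable_coord i) measurable_snd).
exact: measurable_funM.
Qed.

Definition energy_density w (z : vec * vec) : R :=
  `|w z.1 - w z.2| `^ p * frac_kernel z.

Definition flux_density u w (z : vec * vec) : R :=
  pflux p (u z.1 - u z.2) * (w z.1 - w z.2) * frac_kernel z.

Lemma energy_density_ge0 w z : 0 <= energy_density w z.
Proof. by rewrite mulr_ge0 ?powR_ge0 ?frac_kernel_ge0. Qed.

Lemma measurable_increment w : measurable_fun setT w ->
  measurable_fun setT (fun z : vec * vec => w z.1 - w z.2).
Proof.
move=> mw; apply: measurable_funB.
- exact: (measurableT_comp mw measurable_fst).
- exact: (measurableT_comp mw measurable_snd).
Qed.

Lemma measurable_energy_density w : measurable_fun setT w ->
  measurable_fun setT (energy_density w).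
Proof.
move=> mw; apply: measurable_funM; last exact: measurable_frac_kernel.
apply: (measurableT_comp (measurable_powR _)).
apply: measurableT_comp => //; exact: measurable_increment.
Qed.

Lemma measurable_flux_density u w : measurable_fun setT u ->
  measurable_fun setT w -> measurable_fun setT (flux_density u w).
Proof.
move=> /measurable_increment mu_ /measurable_increment mw.
apply: measurable_funM; last exact: measurable_frac_kernel.
apply: measurable_funM => //; apply: measurable_funM => //.
apply: (measurableT_comp (measurable_powR _)).
by apply: measurableT_comp => //; exact: measurable_increment.
Qed.

Lemma gagliardo_lty w : (gagliardo s p w < +oo)%E <->
  (\int[mu \x mu]_z (energy_density w z)%:E < +oo)%E.
Proof.
have p_neq0 : p^-1 != 0 by rewrite invr_eq0 gt_eqF// (lt_trans _ p_gt1).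
rewrite /gagliardo /energy_density /frac_kernel; split; last exact: poweR_lty.
by rewrite !ltey; apply: contra => /eqP ->; rewrite poweRyr.
Qed.

Lemma frac_pLaplacianE u w :
  frac_pLaplacian s p u w = (\int[mu \x mu]_z (flux_density u w z)%:E)%E.
Proof. by []. Qed.

Lemma gagliardo_dominated (C : R) u v w : 0 <= C ->
  measurable_fun setT u -> measurable_fun setT v -> measurable_fun setT w ->
  {ae (mu \x mu)%E, forall z,
     `|w z.1 - w z.2| <= C * (`|u z.1 - u z.2| + `|v z.1 - v z.2|)} ->
  (gagliardo s p u < +oo)%E -> (gagliardo s p v < +oo)%E ->
  (gagliardo s p w < +oo)%E.
Proof.
move=> C0 mu_ mv mw wuv /gagliardo_lty Eu /gagliardo_lty Ev; apply/gagliardo_lty.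
have mE f := @measurable_energy_density f.
have E0 f := @energy_density_ge0 f.
apply: (ae_dominated_integral_lty (powR_ge0 (C * 2) p) (mE w mw) (mE u mu_)
  (mE v mv) (E0 w) (E0 u) (E0 v) _ Eu Ev).
apply: filterS wuv => z /(test_powR_le p_gt1 C0) wuvz.
by rewrite /energy_density -mulrDl mulrA ler_wpM2r ?frac_kernel_ge0.
Qed.

Lemma integrable_energy_density w : measurable_fun setT w ->
  (gagliardo s p w < +oo)%E ->
  (mu \x mu)%E.-integrable setT (EFin \o energy_density w).
Proof.
move=> mw /gagliardo_lty Ew; apply/integrableP; split.
  by apply/measurable_EFinP; exact: measurable_energy_density.
by under eq_integral => z _ do rewrite gee0_abs ?lee_fin ?energy_density_ge0//.
Qed.

(** Young's inequality in the crude form of [pfluxM_le] bounds the flux density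
    by the sum of the two energy densities. *)
Lemma integrable_flux_density u w :
  measurable_fun setT u -> measurable_fun setT w ->
  (gagliardo s p u < +oo)%E -> (gagliardo s p w < +oo)%E ->
  (mu \x mu)%E.-integrable setT (EFin \o flux_density u w).
Proof.
move=> mu_ mw Eu Ew.
apply: (@le_integrable _ _ _ _ _ _ _
  ((EFin \o energy_density u) \+ (EFin \o energy_density w))%E) => //.
- by apply/measurable_EFinP; exact: measurable_flux_density.
- move=> z _; rewrite lee_fin [leRHS]ger0_norm; last first.
    by rewrite addr_ge0 ?energy_density_ge0.
  rewrite normrM (ger0_norm (frac_kernel_ge0 z)) -mulrDl.
  by rewrite ler_wpM2r ?frac_kernel_ge0// pfluxM_le.
- by apply: integrableD => //; exact: integrable_energy_density.
Qed.

Lemma LfunP u : u \in Lfun mu p%:E <->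
  measurable_fun setT u /\ (\int[mu]_x (`|u x| `^ p)%:E < +oo)%E.
Proof.
have p_neq0 : p^-1 != 0 by rewrite invr_eq0 gt_eqF// (lt_trans _ p_gt1).
have Lnorm_lty : ('N[mu]_p%:E[EFin \o u] < +oo)%E <->
    (\int[mu]_x (`|u x| `^ p)%:E < +oo)%E.
  rewrite unlock /=; split; last exact: poweR_lty.
  by rewrite !ltey; apply: contra => /eqP ->; rewrite poweRyr.
split=> [/andP[]|[mf Lf]].
  by rewrite !inE => mf /Lnorm_lty.
by apply/andP; rewrite !inE; split => //; apply/Lnorm_lty.
Qed.

Lemma Lfun_dominated (C : R) u v w : 0 <= C ->
  u \in Lfun mu p%:E -> v \in Lfun mu p%:E -> measurable_fun setT w ->
  {ae mu, forall x, `|w x| <= C * (`|u x| + `|v x|)} ->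
  w \in Lfun mu p%:E.
Proof.
move=> C0 /LfunP[mu_ Lu] /LfunP[mv Lv] mw wuv; apply/LfunP; split; first exact: mw.
have mpow (f : vec -> R) : measurable_fun setT f ->
    measurable_fun setT (fun x : vec => `|f x| `^ p).
  move=> mf; apply: (measurableT_comp (measurable_powR _)).
  exact: measurableT_comp.
have pow0 (f : vec -> R) x : 0 <= `|f x| `^ p by exact: powR_ge0.
apply: (ae_dominated_integral_lty (powR_ge0 (C * 2) p) (mpow w mw) (mpow u mu_)
  (mpow v mv) (pow0 w) (pow0 u) (pow0 v) _ Lu Lv).
by apply: filterS wuv => x /(test_powR_le p_gt1 C0).
Qed.

End energy.

(** * Comparability of functions in the interior of the cone *)

Section int_C0s.
Context {R : realType} {N : nat}.
Local Notation vec := 'rV[R]_N.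
Implicit Types (Omega : set vec) (u v : vec -> R).

Lemma compact_closure_bounded Omega : bounded_set Omega -> compact (closure Omega).
Proof.
move=> [M [_ bM]]; apply: bounded_closed_compact; last exact: closed_closure.
have clM : closed [set x : vec | `|x| <= M + 1].
  have /(continuous_closedP (fun x : vec => `|x| : R)).1 := @norm_continuous R vec.
  by move=> /(_ [set y | y <= M + 1]); apply; exact: closed_le.
exists (M + 1); split; first exact: num_real.
move=> r Mr x xcl; apply: ltW; apply: le_lt_trans Mr.
have := closure_subset
  (fun y Oy => bM (M + 1) _ y Oy : [set x | `|x| <= M + 1] y) xcl.
by rewrite -(closure_id _).1//; apply; rewrite ltrDl.
Qed.

Lemma continuous_closure_bounded Omega (g : vec -> R) : bounded_set Omega ->
  {within closure Omega, continuous g} ->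
  exists2 M, 0 < M & forall x, Omega x -> `|g x| <= M.
Proof.
move=> /compact_closure_bounded cO cg.
have [M [_ bM]] := compact_bounded (continuous_compact cg cO).
exists (`|M| + 1); first by rewrite ltr_pwDr.
move=> x Ox; apply: bM; first by rewrite ltr_pwDr// ler_norm.
by exists x => //; exact: subset_closure.
Qed.

(** The lower bound is the positive infimum of the quotient; the upper bound
    holds because the quotient extends continuously to the compact closure. *)
Lemma int_C0s_nneg_bounds Omega s u : bounded_set Omega ->
  int_C0s_nneg Omega s u ->
  exists m M, [/\ 0 < m, 0 < M & forall x, Omega x ->
    [/\ 0 < dist_compl Omega x `^ s,
      m * dist_compl Omega x `^ s <= u x & u x <= M * dist_compl Omega x `^ s]].
Proof.
move=> bO [[_ [g [cg gE]]] infu].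
have [M M0 gM] := continuous_closure_bounded bO cg.
set S := (X in inf X) in infu.
exists (inf S), M; split => // x Ox.
have lbS : has_lbound S.
  (* a set without lower bound has infimum zero *)
  by apply: contrapT => nl; move: infu; rewrite inf_out ?ltxx// => -[].
have infx : inf S <= u x / dist_compl Omega x `^ s.
  by apply: ge_inf => //; exists x.
have D0 : 0 < dist_compl Omega x `^ s.
  (* division by zero gives zero, which is below the infimum *)
  rewrite lt_neqAle powR_ge0 andbT; apply/eqP => D0.
  by move: infx; rewrite -D0 invr0 mulr0 leNgt infu.
split => //; first by rewrite -ler_pdivlMr.
rewrite -ler_pdivrMr// -gE//; apply: le_trans (gM _ Ox); exact: ler_norm.
Qed.

Lemma int_C0s_nneg_comparable Omega s u v : bounded_set Omega ->
  int_C0s_nneg Omega s u -> int_C0s_nneg Omega s v ->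
  exists2 K, 0 <= K & forall x, Omega x ->
    [/\ 0 < u x, 0 < v x, u x <= K * v x & v x <= K * u x].
Proof.
move=> bO /(int_C0s_nneg_bounds bO)[m [M [m0 M0 ub]]].
move=> /(int_C0s_nneg_bounds bO)[m' [M' [m0' M0' vb]]].
have H0 : 0 < M / m by rewrite divr_gt0.
have H1 : 0 < M / m' by rewrite divr_gt0.
have H2 : 0 < M' / m by rewrite divr_gt0.
exists (M / m' + M' / m); first by rewrite addr_ge0// ltW.
move=> x Ox; have [D0 um uM] := ub _ Ox; have [_ vm vM] := vb _ Ox.
set D := dist_compl Omega x `^ s in D0 um uM vm vM.
have u0 : 0 < u x by apply: lt_le_trans um; rewrite mulr_gt0.
have v0 : 0 < v x by apply: lt_le_trans vm; rewrite mulr_gt0.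
split => //.
- apply: (le_trans uM); apply: (@le_trans _ _ (M / m' * v x)).
    by rewrite -mulrA ler_pM2l// ler_pdivlMl.
  by rewrite ler_pM2r// lerDl ltW.
- apply: (le_trans vM); apply: (@le_trans _ _ (M' / m * u x)).
    by rewrite -mulrA ler_pM2l// ler_pdivlMl.
  by rewrite ler_pM2r// lerDr ltW.
Qed.

End int_C0s.

Section positivity_and_integrability.
Context {R : realType} {N : nat}.
Local Notation vec := 'rV[R]_N.
Local Notation mu := (@lebesgue_rV R N).
Implicit Types (Omega : set vec) (u v : vec -> R).

(** Up to a null set, [Omega] is [[set x | 0 < u x]], and the Lebesgue measure is
    complete. *)
Lemma positivity_set_measurable Omega u : measurable_fun setT u ->
  (forall x, Omega x -> 0 < u x) -> {ae mu, forall x, ~ Omega x -> u x = 0} ->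
  measurable Omega.
Proof.
move=> mu_ u0 uout.
have mpos : measurable [set x | 0 < u x].
  rewrite -[X in measurable X]setTI.
  rewrite (_ : [set x | 0 < u x] = u @^-1` `]0, +oo[%classic).
    by apply: mu_ => //; exact: measurable_itv.
  by apply/seteqP; split => x /=; rewrite in_itv/= andbT.
have neg : measurable [set x | ~ Omega x /\ 0 < u x].
  apply: lebesgue_rV_complete; apply: negligibleS uout => x /= [Ox ux] /(_ Ox) ux0.
  by rewrite ux0 ltxx in ux.
rewrite (_ : Omega = [set x | 0 < u x] `\` [set x | ~ Omega x /\ 0 < u x]).
  exact: measurableD.
apply/seteqP; split => [x Ox|x [ux /not_andP[/contrapT//|//]]].
by split; [exact: u0|case].
Qed.

Lemma ae_bounded_integrable d (T : measurableType d)
    (nu : {measure set T -> \bar R}) (D : set T) (g : T -> R) (B : R) :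
  measurable D -> (nu D < +oo)%E -> 0 <= B -> measurable_fun D g ->
  {ae nu, forall x, D x -> `|g x| <= B} -> nu.-integrable D (EFin \o g).
Proof.
move=> mD Doo B0 mg gB; apply/integrableP; split; first exact/measurable_EFinP.
apply: (@le_lt_trans _ _ (\int[nu]_(x in D) B%:E)%E).
  apply: ae_ge0_le_integral => //.
  by apply: measurableT_comp => //; exact/measurable_EFinP.
by rewrite integral_cst ?lte_mul_pinfty ?lee_fin.
Qed.

End positivity_and_integrability.

(** * The Diaz-Saa inequality and the comparison principle *)

Section weak_comparison.
Context {R : realType} {N : nat}.
Local Notation vec := 'rV[R]_N.
Local Notation mu := (@lebesgue_rV R N).
Implicit Types (Omega : set vec) (u v w : vec -> R).

(** The test functions [(u^p - v^p)^+ / u^(p-1)], for [w = u], and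
    [(u^p - v^p)^+ / v^(p-1)], for [w = v]. *)
Definition picone_test p u v w (x : vec) : R :=
  ppow_excess p (u x) (v x) * w x `^ (1 - p).

Lemma measurable_picone_test p u v w :
  measurable_fun setT u -> measurable_fun setT v -> measurable_fun setT w ->
  measurable_fun setT (picone_test p u v w).
Proof.
have mpow q (g : vec -> R) : measurable_fun setT g ->
    measurable_fun setT (fun x => g x `^ q).
  by move=> mg; exact: (measurableT_comp (measurable_powR _)).
move=> mu_ mv mw; apply: measurable_funM; last exact: mpow.
apply: measurable_maxr; last exact: measurable_cst.
by apply: measurable_funB; exact: mpow.
Qed.

Lemma W0_measurable Omega s p w : W0 Omega s p w -> measurable_fun setT w.
Proof. by case=> /sub_Lfun_mfun; rewrite inE. Qed.

Lemma ae_comparable_pair Omega s p K u v : 0 <= K ->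
  W0 Omega s p u -> W0 Omega s p v ->
  (forall x, Omega x -> [/\ 0 < u x, 0 < v x, u x <= K * v x & v x <= K * u x]) ->
  {ae mu, forall x, comparable_pair K (u x) (v x)}.
Proof.
move=> K0 [_ _ u0] [_ _ v0] uv; apply: filterS2 u0 v0 => x u0 v0.
have [/uv[ux vx uKv vKu]|/[dup] /u0 -> /v0 ->] := pselect (Omega x).
  by split => //; left.
by split; rewrite ?mulr0//; right.
Qed.

(** Inside the comparability cone the test functions are Lipschitz functions of
    the pair [(u, v)], so that they inherit integrability and finite energy. *)
Lemma picone_test_W0_nneg Omega s p K u v w : 1 < p -> 0 <= K ->
  W0 Omega s p u -> W0 Omega s p v -> measurable_fun setT w ->
  {ae mu, forall x, comparable_pair K (u x) (v x)} ->
  (forall x y, comparable_pair K (u x) (v x) -> comparable_pair K (u y) (v y) ->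
    `|picone_test p u v w x - picone_test p u v w y| <=
      test_lip p K * (`|u x - u y| + `|v x - v y|)) ->
  (forall x, comparable_pair K (u x) (v x) ->
    `|picone_test p u v w x| <= test_lip p K * (`|u x| + `|v x|)) ->
  W0_nneg Omega s p (picone_test p u v w).
Proof.
move=> p1 K0 uW vW mw uv lip bnd; have p0 : 0 <= p by lra.
have L0 := test_lip_ge0 p0 K0.
have mu_ := W0_measurable uW; have mv := W0_measurable vW.
have mphi := measurable_picone_test p mu_ mv mw.
case: uW vW => [uL uE u0] [vL vE v0]; split; last first.
  by apply: aeW => x; rewrite mulr_ge0 ?ppow_excess_ge0 ?powR_ge0.
split.
- apply: (Lfun_dominated p1 L0 uL vL mphi).
  by apply: filterS uv => x; exact: bnd.
- apply: (gagliardo_dominated p1 L0 mu_ mv mphi _ uE vE).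
  by apply: filterS (ae_prod uv uv) => z [z1 z2]; exact: lip.
- apply: filterS2 u0 v0 => x u0 v0 Ox.
  by rewrite /picone_test u0// v0// ppow_excess_le// mul0r.
Qed.

(** The inequality [diaz_saa_pointwise] integrated against the kernel; both
    integrals are finite since all four functions have finite energy. *)
Lemma diaz_saa Omega s p K u v (phi := picone_test p u v u)
    (psi := picone_test p u v v) : 1 < p ->
  W0 Omega s p u -> W0 Omega s p v ->
  {ae mu, forall x, comparable_pair K (u x) (v x)} ->
  W0 Omega s p phi -> W0 Omega s p psi ->
  (frac_pLaplacian s p v psi <= frac_pLaplacian s p u phi)%E.
Proof.
move=> p1 uW vW uv phiW psiW.
have [mu_ mv] := (W0_measurable uW, W0_measurable vW).
have [mphi mpsi] := (W0_measurable phiW, W0_measurable psiW).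
case: uW vW phiW psiW => [_ uE _] [_ vE _] [_ phiE _] [_ psiE _].
have Fv := integrable_flux_density p1 mv mpsi vE psiE.
have Fu := integrable_flux_density p1 mu_ mphi uE phiE.
rewrite !frac_pLaplacianE; apply: (ae_le_integral measurableT Fv Fu).
apply: filterS (ae_prod uv uv) => z [[z1 _ _] [z2 _ _]] _.
by rewrite ler_wpM2r ?frac_kernel_ge0// diaz_saa_pointwise.
Qed.

(** The two integrands are [f x w / w^(p-1)] times [(u^p - v^p)^+], for [w = u]
    and [w = v].  Where [v < u] the first is strictly smaller, because
    [f x t / t^(p-1)] decreases; elsewhere both vanish.  So the reverse inequality
    of the integrals confines [v < u] to a null set. *)
Lemma comparison_of_integrals Omega (f : vec -> R -> R) p u v
    (phi := picone_test p u v u) (psi := picone_test p u v v) :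
  1 < p -> measurable Omega ->
  (forall x, Omega x -> 0 < u x /\ 0 < v x) ->
  {ae mu, forall x, Omega x -> forall t1 t2 : R, 0 < t1 -> t1 < t2 ->
     f x t2 / t2 `^ (p - 1) < f x t1 / t1 `^ (p - 1)} ->
  mu.-integrable Omega (EFin \o (fun x => f x (u x) * phi x)) ->
  mu.-integrable Omega (EFin \o (fun x => f x (v x) * psi x)) ->
  (\int[mu]_(x in Omega) (f x (v x) * psi x)%:E <=
   \int[mu]_(x in Omega) (f x (u x) * phi x)%:E)%E ->
  {ae mu, forall x, Omega x -> u x <= v x}.
Proof.
move=> p1 mO pos f_decr iphi ipsi le_int; have p0 : 0 < p by lra.
have E x w : f x (w x) * picone_test p u v w x =
    f x (w x) / w x `^ (p - 1) * ppow_excess p (u x) (v x).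
  by rewrite /picone_test powRN1p; ring.
have strict x : Omega x -> (forall t1 t2 : R, 0 < t1 -> t1 < t2 ->
     f x t2 / t2 `^ (p - 1) < f x t1 / t1 `^ (p - 1)) -> v x < u x ->
    f x (u x) * phi x < f x (v x) * psi x.
  move=> /pos[u0 v0] decr vu; rewrite !E ltr_pM2r ?decr//.
  by rewrite ppow_excess_gt0// ltW.
have le_ae : {ae mu, forall x, Omega x -> f x (u x) * phi x <= f x (v x) * psi x}.
  apply: filterS f_decr => x decr Ox; have [u0 v0] := pos _ Ox.
  have [uv|vu] := leP (u x) (v x); last exact/ltW/strict/vu/decr.
  by rewrite !E ppow_excess_le ?(ltW p0) ?(ltW u0)// !mulr0.
apply: filterS2 f_decr (ae_le_integral_eq mO iphi ipsi le_ae le_int) => x decr eq Ox.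
rewrite leNgt; apply/negP => vu.
by have := strict x Ox (decr Ox) vu; rewrite eq// ltxx.
Qed.

Lemma reaction_integrable Omega (f : vec -> R -> R) (c0 q B B' : R) u w :
  measurable Omega -> bounded_set Omega -> caratheodory_fun Omega f ->
  0 <= c0 -> 0 <= q -> 0 <= B' ->
  {ae mu, forall x, Omega x -> forall t : R, `|f x t| <= c0 * (1 + `|t| `^ q)} ->
  measurable_fun setT u -> measurable_fun setT w ->
  (forall x, Omega x -> `|u x| <= B) ->
  (forall x, Omega x -> `|w x| <= B') ->
  mu.-integrable Omega (EFin \o (fun x => f x (u x) * w x)).
Proof.
move=> mO bO [mf cf] c00 q0 B0' growth mu_ mw uB wB.
have C0 : 0 <= c0 * (1 + B `^ q) by rewrite mulr_ge0// addr_ge0// powR_ge0.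
apply: (@ae_bounded_integrable _ _ _ _ _ _ (c0 * (1 + B `^ q) * B')).
- exact: mO.
- exact: bounded_set_lebesgue_lty.
- exact: mulr_ge0.
- apply: measurable_funM; last exact: measurable_funTS.
  apply: (caratheodory_comp_measurable (@lebesgue_rV_complete R N)) => //.
  exact: measurable_funTS.
apply: filterS growth => x growth Ox; rewrite normrM ler_pM ?wB//.
apply: le_trans (growth Ox _) _; rewrite ler_wpM2l// lerD2l.
by rewrite ge0_ler_powR ?nnegrE ?uB// (le_trans _ (uB x Ox)).
Qed.

End weak_comparison.

Unset Implicit Arguments.

Theorem theorem2p8 (R : realType) (N : nat) (N_ge2 : (2 <= N)%N)
  (Omega : set 'rV[R]_N)
  (Omega_open : open Omega) (Omega_conn : connected Omega)
  (Omega_nonempty : Omega !=set0) (Omega_bounded : bounded_set Omega)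
  (Omega_C11 : C11_boundary Omega)
  (s p : R) (s_gt0 : 0 < s) (s_lt1 : s < 1) (p_ge2 : 2 <= p)
  (ps_ltN : p * s < N%:R)
  (f : 'rV[R]_N -> R -> R) (f_carath : caratheodory_fun Omega f)
  (c0 r : R) (c0_gt0 : 0 < c0)
  (r_gtp : p < r) (r_lt_pstar : r < N%:R * p / (N%:R - p * s))
  (f_growth : {ae @lebesgue_rV R N, forall x, Omega x ->
     forall t : R, `|f x t| <= c0 * (1 + `|t| `^ (r - 1))})
  (f_decr : {ae @lebesgue_rV R N, forall x, Omega x ->
     forall t1 t2 : R, 0 < t1 -> t1 < t2 ->
       f x t2 / t2 `^ (p - 1) < f x t1 / t1 `^ (p - 1)})
  (u v : 'rV[R]_N -> R)
  (u_int : int_C0s_nneg Omega s u) (v_int : int_C0s_nneg Omega s v)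
  (u_sub : weak_subsolution Omega s p f u)
  (v_super : weak_supersolution Omega s p f v) :
  {ae @lebesgue_rV R N, forall x, Omega x -> u x <= v x}.
Proof.
have p1 : 1 < p by lra.
have r1 : 0 <= r - 1 by lra.
have p0 : 0 <= p by lra.
have [K K0 uv] := int_C0s_nneg_comparable Omega_bounded u_int v_int.
have [uW u_le] := u_sub; have [vW v_ge] := v_super.
have [mu_ mv] := (W0_measurable uW, W0_measurable vW).
have uv_ae := ae_comparable_pair K0 uW vW uv.
have mO : measurable Omega.
  by case: uW => _ _; apply: positivity_set_measurable => // x /uv[].
(* comparison with the exterior value turns the Lipschitz bounds into bounds *)
have zero_pair : comparable_pair K (0 : R) 0.
  by split; [right|rewrite mulr0|rewrite mulr0].
have zero_test (q : R) : ppow_excess p (0 : R) 0 * 0 `^ q = 0.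
  by rewrite ppow_excess_le// mul0r.
have phi_bnd : forall x, comparable_pair K (u x) (v x) ->
    `|picone_test p u v u x| <= test_lip p K * (`|u x| + `|v x|).
  move=> x ux; have := test_sub_lipschitz p1 K0 ux zero_pair.
  by rewrite zero_test !subr0.
have psi_bnd : forall x, comparable_pair K (u x) (v x) ->
    `|picone_test p u v v x| <= test_lip p K * (`|u x| + `|v x|).
  move=> x ux; have := test_sup_lipschitz p1 K0 ux zero_pair.
  by rewrite zero_test !subr0.
have phiW : W0_nneg Omega s p (picone_test p u v u).
  apply: (picone_test_W0_nneg p1 K0 uW vW mu_ uv_ae _ phi_bnd) => x y.
  exact: test_sub_lipschitz.
have psiW : W0_nneg Omega s p (picone_test p u v v).
  apply: (picone_test_W0_nneg p1 K0 uW vW mv uv_ae _ psi_bnd) => x y.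
  exact: test_sup_lipschitz.
have [Bu Bu0 uB] := continuous_closure_bounded Omega_bounded u_int.1.1.
have [Bv Bv0 vB] := continuous_closure_bounded Omega_bounded v_int.1.1.
have pair x : Omega x -> comparable_pair K (u x) (v x).
  by move=> /uv[ux vx uKv vKu]; split => //; left.
pose B := test_lip p K * (Bu + Bv).
have B0 : 0 <= B by rewrite mulr_ge0 ?test_lip_ge0// addr_ge0// ltW.
have leB x : Omega x -> test_lip p K * (`|u x| + `|v x|) <= B.
  by move=> Ox; rewrite ler_wpM2l ?test_lip_ge0// lerD ?uB ?vB.
apply: (comparison_of_integrals p1 mO _ f_decr).
- by move=> x /uv[].
- apply: (reaction_integrable mO Omega_bounded f_carath (ltW c0_gt0) r1 B0 f_growth
    mu_ (W0_measurable phiW.1) uB) => x Ox.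
  exact: le_trans (phi_bnd _ (pair _ Ox)) (leB _ Ox).
- apply: (reaction_integrable mO Omega_bounded f_carath (ltW c0_gt0) r1 B0 f_growth
    mv (W0_measurable psiW.1) vB) => x Ox.
  exact: le_trans (psi_bnd _ (pair _ Ox)) (leB _ Ox).
apply: le_trans (v_ge _ psiW) _; apply: le_trans (u_le _ phiW).
exact: (diaz_saa p1 uW vW uv_ae phiW.1 psiW.1).
Qed.
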